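(* For every integer $d\ge 1$, the set of all restricted shuffles is a generating subset of the group $\operatorname{Rec}_d$.
   Context: A rectangle in $\mathbb{R}^d$ is a set $\prod_{i=1}^d[a_i,b_i)$ with $a_i<b_i$ real numbers (a product of bounded left-closed right-open intervals). A multirectangle is a finite union of rectangles. For a multirectangle $M\subseteq\mathbb{R}^d$, $\operatorname{Rec}_d(M)$ denotes the group, under composition, of all bijections $f:M\to M$ for which there exists a finite partition of $M$ into rectangles such that the restriction of $f$ to each piece is a translation. We write $\operatorname{Rec}_d=\operatorname{Rec}_d([0,1)^d)$; $\operatorname{Rec}_1$ is the group $\operatorname{IET}$ of interval exchange transformations. Let $e_1,\dots,e_d$ be the standard basis of $\mathbb{R}^d$. A restricted shuffle (in direction $i$) in $\operatorname{Rec}_d(M)$ is defined as follows: take a rectangle $P=\prod_{j=1}^d[a_j,b_j)\subseteq M$, an index $i\in\{1,\dots,d\}$ and $c\in(a_i,b_i)$; let $P'$ (resp. $P''$) be the rectangle obtained from $P$ by replacing the factor $[a_i,b_i)$ by $[a_i,c)$ (resp. $[c,b_i)$). The restricted shuffle is the element of $\operatorname{Rec}_d(M)$ which is translation by $(b_i-c)e_i$ on $P'$, translation by $-(c-a_i)e_i$ on $P''$, and the identity outside $P$ (it exchanges the two adjacent rectangles $P'$ and $P''$). For $d=1$ these are the restricted rotations. *)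

(* Defs.v *)
From Stdlib Require Import Reals.
From mathcomp Require Import all_boot.
Set Implicit Arguments. Unset Strict Implicit. Unset Printing Implicit Defensive.
Local Open Scope R_scope.

Definition pt (d : nat) := 'I_d -> R.

Definition vadd d (x v : pt d) : pt d := fun i => x i + v i.

Definition evec d (i : 'I_d) (t : R) : pt d := fun j => if j == i then t else 0.

Definition in_rect d (a b : pt d) (x : pt d) : Prop :=
  forall i, a i <= x i /\ x i < b i.

Definition proper_rect d (a b : pt d) : Prop := forall i, a i < b i.

Definition in_cube d (x : pt d) : Prop := forall i, 0 <= x i /\ x i < 1.

(* Elements of Rec_d are represented canonically by maps R^d -> R^d that are
   the identity outside [0,1)^d. A piece is (a, b, v): rectangle [a,b) and
   translation vector v. *)
Definition is_Rec d (f : pt d -> pt d) : Prop :=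
  (forall x, ~ in_cube x -> f x = x) /\
  (forall x, in_cube x -> in_cube (f x)) /\
  (forall x y, in_cube x -> in_cube y -> f x = f y -> x = y) /\
  (forall y, in_cube y -> exists x, in_cube x /\ f x = y) /\
  exists (s : seq (pt d * pt d * pt d)) (p0 : pt d * pt d * pt d),
    (forall j, (j < size s)%N -> proper_rect (nth p0 s j).1.1 (nth p0 s j).1.2) /\
    (forall j x, (j < size s)%N -> in_rect (nth p0 s j).1.1 (nth p0 s j).1.2 x ->
        in_cube x) /\
    (forall x, in_cube x -> exists j, (j < size s)%N /\
        in_rect (nth p0 s j).1.1 (nth p0 s j).1.2 x) /\
    (forall j k x, (j < size s)%N -> (k < size s)%N -> j <> k ->
        ~ (in_rect (nth p0 s j).1.1 (nth p0 s j).1.2 x /\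
           in_rect (nth p0 s k).1.1 (nth p0 s k).1.2 x)) /\
    (forall j x, (j < size s)%N -> in_rect (nth p0 s j).1.1 (nth p0 s j).1.2 x ->
        f x = vadd x (nth p0 s j).2).

Definition is_restricted_shuffle d (f : pt d -> pt d) : Prop :=
  exists (a b : pt d) (i : 'I_d) (c : R),
    proper_rect a b /\
    (forall x, in_rect a b x -> in_cube x) /\
    a i < c < b i /\
    let a'' := fun j => if j == i then c else a j in
    let b'  := fun j => if j == i then c else b j in
    (forall x, in_rect a b' x -> f x = vadd x (evec i (b i - c))) /\
    (forall x, in_rect a'' b x -> f x = vadd x (evec i (- (c - a i)))) /\
    (forall x, ~ in_rect a b x -> f x = x).

Inductive generated d (S : (pt d -> pt d) -> Prop) : (pt d -> pt d) -> Prop :=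
  | gen_id : generated S (fun x => x)
  | gen_mul : forall s g, S s -> generated S g -> generated S (fun x => s (g x))
  | gen_mul_inv : forall s t g, S s -> (forall x, s (t x) = x) ->
      (forall x, t (s x) = x) -> generated S g -> generated S (fun x => t (g x)).

(* Main.v *)
Require Import Defs.
From Stdlib Require Import Reals.
From mathcomp Require Import all_boot.
From mathcomp Require Import all_order all_algebra fingroup perm.
From mathcomp Require Import ring lra.
From mathcomp Require Import boolp Rstruct.
(* fingroup shadows [generated]. *)
Import Defs.
Set Implicit Arguments. Unset Strict Implicit. Unset Printing Implicit Defensive.
Import Order.TTheory GRing.Theory Num.Theory.
Local Open Scope ring_scope.

(** Let f in Rec_d be given by pieces [a_j, b_j) and translations v_j. Finitely many positive
    reals are natural combinations of finitely many positive reals that are linearly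
    independent over Q. Hence [0,1) can be cut into intervals, with lengths in such an
    independent family, so that all coordinates of all a_j, b_j, a_j + v_j, b_j + v_j are
    cutting points. In each direction the j-th piece and its image are then subdivided into
    intervals of the same total length, so by independence the lengths agree up to order, and
    products of restricted shuffles inside the piece make the two subdivisions equal.
    Precomposing f with these shuffles gives a map that permutes by translations the cells of
    a single grid of the cube. Such a map is a product of transpositions of cells of equal
    shape, hence of transpositions of cells differing in one coordinate, each of which is a
    product of at most two restricted shuffles. *)

(** * Positive bases *)

Section Basis.
Variable F : realFieldType.
Implicit Types (u : nat -> F) (c : nat -> rat) (n : nat).

Definition lincomb n u c : F := \sum_(i < n) ratr (c i) * u i.

Definition indep n u := forall c, lincomb n u c = 0 -> forall i, (i < n)%N -> c i = 0.

Definition positive n u := forall i, (i < n)%N -> 0 < u i.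

Definition in_cone n u x := exists2 c, (forall i, 0 <= c i) & x = lincomb n u c.

Lemma in_cone_gen n u i : (i < n)%N -> in_cone n u (u i).
Proof.
move=> lin; exists (fun k => (k == i)%:R) => [k|]; first by rewrite ler0n.
rewrite /lincomb (bigD1 (Ordinal lin)) //= eqxx rmorph1 mul1r big1 ?addr0 // => k.
by rewrite -val_eqE /= => /negPf ->; rewrite rmorph0 mul0r.
Qed.

Lemma in_coneD n u x y : in_cone n u x -> in_cone n u y -> in_cone n u (x + y).
Proof.
move=> [c c0 ->] [e e0 ->]; exists (fun k => c k + e k) => [k|]; first exact: addr_ge0.
by rewrite /lincomb -big_split; apply: eq_bigr => k _; rewrite /= rmorphD mulrDl.
Qed.

Lemma in_coneZ n u q x : 0 <= q -> in_cone n u x -> in_cone n u (ratr q * x).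
Proof.
move=> q0 [c c0 ->]; exists (fun k => q * c k) => [k|]; first exact: mulr_ge0.
by rewrite /lincomb mulr_sumr; apply: eq_bigr => k _; rewrite rmorphM mulrA.
Qed.

Lemma in_cone_trans n m u v x :
  (forall i, (i < n)%N -> in_cone m v (u i)) -> in_cone n u x -> in_cone m v x.
Proof.
move=> uv [c c0 ->]; rewrite /lincomb; elim/big_ind: _ => [|y z|i _].
- exists (fun=> 0) => //; rewrite /lincomb big1 // => k _.
  by rewrite rmorph0 mul0r.
- exact: in_coneD.
- exact: in_coneZ (c0 _) (uv _ (ltn_ord i)).
Qed.

(** An elementary change of basis. For [t >= 0] the old vectors stay in the cone of the new ones, so
    what was already in the cone is not lost. *)
Definition shear u p q (t : rat) i := if i == p then u p - ratr t * u q else u i.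

Lemma lincomb_shear n u p q t c : (p < n)%N -> (q < n)%N -> p != q ->
  lincomb n (shear u p q t) c =
  lincomb n u (fun i => if i == q then c q - t * c p else c i).
Proof.
move=> lp lq npq; rewrite /lincomb.
rewrite (bigD1 (Ordinal lp)) // [RHS](bigD1 (Ordinal lp)) //=.
rewrite (bigD1 (Ordinal lq)) 1?eq_sym //= [in RHS](bigD1 (Ordinal lq)) 1?eq_sym //=.
rewrite /shear !eqxx (negPf npq) eq_sym (negPf npq) rmorphB rmorphM /=.
rewrite [in RHS](eq_bigr (fun i : 'I_n => ratr (c i) *
  (if i == p :> nat then u p - ratr t * u q else u i))); first by ring.
move=> i /andP[]; rewrite -!val_eqE /= => /negPf -> /negPf ->; by [].
Qed.

(** The coefficient at [p] is untouched by the substitution, so it vanishes first, and with it the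
    correction at [q]. *)
Lemma indep_shear n u p q t : (p < n)%N -> (q < n)%N -> p != q ->
  indep n u -> indep n (shear u p q t).
Proof.
move=> lp lq npq ind c; rewrite lincomb_shear // => /ind c0.
have cp : c p = 0 by have := c0 p lp; rewrite (negPf npq).
move=> i li; have := c0 i li; case: eqP => [->|//].
by rewrite cp mulr0 subr0.
Qed.

Lemma in_cone_shear n u p q t i : (p < n)%N -> (q < n)%N -> p != q -> 0 <= t ->
  (i < n)%N -> in_cone n (shear u p q t) (u i).
Proof.
move=> lp lq npq t0 li; have [->|nip] := eqVneq i p.
  have -> : u p = shear u p q t p + ratr t * shear u p q t q.
    by rewrite /shear eqxx eq_sym (negPf npq) subrK.
  by apply: in_coneD; [|apply: in_coneZ => //]; apply: in_cone_gen.
have -> : u i = shear u p q t i by rewrite /shear (negPf nip).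
exact: in_cone_gen.
Qed.

(* Two coefficients of opposite signs: one shear, in the direction which keeps the basis
   positive, kills one of them. *)
Lemma absorb n u c : indep n u -> positive n u -> 0 < lincomb n u c ->
  exists v, [/\ indep n v, positive n v, forall i, (i < n)%N -> in_cone n v (u i)
    & in_cone n v (lincomb n u c)].
Proof.
(* Induction on the number of nonzero coefficients. *)
have [m] := ubnP #|[set i : 'I_n | c i != 0]|.
elim: m u c => // m IH u c; rewrite ltnS => le_m ind pos gt0.
case: (pselect (forall i, (i < n)%N -> 0 <= c i)) => [c0|].
  exists u; split=> // [i|]; first exact: in_cone_gen.
  (* [in_cone] asks for nonnegative coefficients at every index, so those beyond [n] are replaced by
     0. *)
  exists (fun i => if (i < n)%N then c i else 0) => [i|].
    by case: ifP => // /c0.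
  by apply: eq_bigr => i _; rewrite ltn_ord.
have step p q : (p < n)%N -> (q < n)%N -> p != q -> c p * c q < 0 ->
    ratr (- (c q / c p)) * u q < u p ->
    exists v, [/\ indep n v, positive n v, forall i, (i < n)%N -> in_cone n v (u i)
    & in_cone n v (lincomb n u c)].
  move=> lp lq npq sgn lt_pq; set t := - (c q / c p) in lt_pq.
  have cp0 : c p != 0 by apply: contraTneq sgn => ->; rewrite mul0r ltxx.
  have cq0 : c q != 0 by apply: contraTneq sgn => ->; rewrite mulr0 ltxx.
  have t0 : 0 <= t.
    have -> : t = (- (c p * c q)) * (c p)^-2 by rewrite /t; field.
    by rewrite mulr_ge0 ?invr_ge0 ?sqr_ge0 // oppr_ge0 ltW.
  (* By [lincomb_shear] the coefficient at [q] in the old basis is [0 - t * c p = c q]: the same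
     vector has one nonzero coefficient fewer in the sheared basis. *)
  pose e i := if i == q then 0 else c i.
  have eqe : lincomb n (shear u p q t) e = lincomb n u c.
    rewrite lincomb_shear //; apply: eq_bigr => i _; rewrite /e eqxx (negPf npq) /t.
    by case: eqP => // ->; congr (ratr _ * _); field.
  have [||||v [vi vp vc va]] := IH (shear u p q t) e.
  - apply: leq_trans le_m; apply: proper_card; apply/properP; split.
      by apply/subsetP => i; rewrite !inE /e; case: ifP; rewrite ?eqxx.
    by exists (Ordinal lq); rewrite !inE //= /e eqxx.
  - exact: indep_shear.
  - by move=> i li; rewrite /shear; case: eqP => // _; [rewrite subr_gt0|apply: pos].
  - by rewrite eqe.
  exists v; split=> // [i li|]; last by rewrite -eqe.
  by apply: in_cone_trans vc _; apply: in_cone_shear.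
move=> /existsNP[j] /not_implyP[lj /negP]; rewrite -ltNge => cj.
have [i li ci] : exists2 i, (i < n)%N & 0 < c i.
  apply: contrapT => noi; move: gt0; apply/negP; rewrite -leNgt.
  apply: sumr_le0 => i _; apply: mulr_le0_ge0; last exact/ltW/pos.
  rewrite lerq0 leNgt; apply/negP => ci; apply: noi; by exists i.
have nij : i != j by apply: contraTneq ci => ->; rewrite -leNgt ltW.
have ci' : 0 < ratr (c i) :> F by rewrite ltr0q.
have cj' : ratr (c j) < 0 :> F by rewrite ltrq0.
(* Independence excludes a zero sum of these two terms; the sign of the sum decides which of the two
   shears leaves the basis positive. *)
have nz : ratr (c i) * u i + ratr (c j) * u j != 0.
  apply/eqP => eq0; have := ind (fun k => if (k == i) || (k == j) then c k else 0).
  move=> /(_ _ _ li); rewrite eqxx /= => ci0; move: ci; rewrite ci0 ?ltxx //.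
  rewrite /lincomb (bigD1 (Ordinal li)) //= (bigD1 (Ordinal lj)) 1?eq_sym //=.
  rewrite !eqxx orbT /= addrA eq0 add0r big1 // => k /andP[].
  by rewrite -!val_eqE /= => /negPf -> /negPf ->; rewrite rmorph0 mul0r.
have sgn : c i * c j < 0 by rewrite pmulr_rlt0.
move: nz; rewrite neq_lt => /orP[] h.
- apply: (step j i) => //; [by rewrite eq_sym|by rewrite mulrC|].
  rewrite rmorphN rmorphM fmorphV /= -subr_gt0.
  have -> : u j - - (ratr (c i) / ratr (c j)) * u i =
     (ratr (c i) * u i + ratr (c j) * u j) / ratr (c j).
    by field; rewrite lt_eqF.
  by rewrite nmulr_rgt0 // invr_lt0.
- apply: (step i j) => //.
  rewrite rmorphN rmorphM fmorphV /= -subr_gt0.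
  have -> : u i - - (ratr (c j) / ratr (c i)) * u j =
     (ratr (c i) * u i + ratr (c j) * u j) / ratr (c i).
    by field; rewrite gt_eqF.
  by rewrite divr_gt0.
Qed.

(** A new element independent of the basis is appended to it; otherwise it is a rational combination
    of the basis, and [absorb] changes the basis so that it enters the cone. *)
Lemma positive_basis (s : seq F) : all (fun x => 0 < x) s ->
  exists n u, [/\ indep n u, positive n u & forall x, x \in s -> in_cone n u x].
Proof.
elim: s => [_|a s IH /= /andP[a0 /IH[n [u [ind pos cone]]]]].
  by exists 0, (fun=> 0); split.
pose v i := if (i < n)%N then u i else a.
have vS c : lincomb n.+1 v c = lincomb n u c + ratr (c n) * a.
  rewrite /lincomb big_ord_recr /= /v ltnn; congr (_ + _).
  by apply: eq_bigr => i _; rewrite ltn_ord.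
case: (pselect (indep n.+1 v)) => [vi|].
  exists n.+1, v; split=> // [i _|x].
    by rewrite /v; case: ifP => // /pos.
  rewrite inE => /predU1P[->|/cone].
    have -> : a = v n by rewrite /v ltnn.
    exact: in_cone_gen.
  apply: in_cone_trans => i li; have -> : u i = v i by rewrite /v li.
  exact/in_cone_gen/ltnW.
move=> /existsNP[c] /not_implyP[]; rewrite vS => c0 nc.
have cn0 : c n != 0.
  apply: contra_notN nc => /eqP cn; move: c0; rewrite cn rmorph0 mul0r addr0 => /ind c0 i.
  by rewrite ltnS leq_eqVlt => /predU1P[->|/c0].
pose e i := - (c i / c n).
have ae : a = lincomb n u e.
  have cn0' : ratr (c n) != 0 :> F by rewrite fmorph_eq0.
  have -> : lincomb n u e = - (lincomb n u c) / ratr (c n).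
    rewrite /lincomb mulNr mulr_suml -sumrN; apply: eq_bigr => i _.
    by rewrite /e rmorphN rmorphM fmorphV /=; ring.
  apply: (mulIf cn0'); rewrite divfK //; apply/eqP; rewrite -subr_eq0 opprK mulrC addrC.
  exact/eqP.
have [|v' [vi vp vc va]] := absorb ind pos (c := e); first by rewrite -ae.
exists n, v'; split=> // x; rewrite inE => /predU1P[->|/cone]; first by rewrite ae.
exact: in_cone_trans.
Qed.

(** Freeness up to order: a total length determines the multiset of letters. Only membership in [B]
    matters, so the property passes to subsets. It is all that the study of intervals retains of
    rational independence. *)
Definition free_letters (B : seq F) := forall m m' : seq F,
  {subset m <= B} -> {subset m' <= B} -> \sum_(x <- m) x = \sum_(x <- m') x -> perm_eq m m'.

Lemma sum_count (B m : seq F) : uniq B -> {subset m <= B} ->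
  \sum_(x <- m) x = \sum_(x <- B) (count_mem x m)%:R * x.
Proof.
move=> uB; elim: m => [_|y m IH sub].
  by rewrite big_nil big1 // => x _; rewrite mul0r.
rewrite big_cons IH => [|x xm]; last by apply: sub; rewrite inE xm orbT.
have yB : y \in B by apply: sub; rewrite inE eqxx.
rewrite (bigD1_seq y) //= [RHS](bigD1_seq y) //= eqxx addrA natrD mulrDl mul1r.
by congr (_ + _); apply: eq_bigr => x /negPf; rewrite eq_sym => ->.
Qed.

Lemma indep_inj n u : indep n u -> {in [pred i | (i < n)%N] &, injective u}.
Proof.
move=> ind i j li lj uij; apply/eqP/negPn/negP => nij.
have := ind (fun k => (k == i)%:R - (k == j)%:R) _ i li; rewrite eqxx (negPf nij) subr0.
suff -> : lincomb n u (fun k => (k == i)%:R - (k == j)%:R) = 0.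
  by move=> /(_ erefl)/eqP; rewrite oner_eq0.
rewrite /lincomb (bigD1 (Ordinal li)) // (bigD1 (Ordinal lj)) 1?eq_sym //=.
rewrite !eqxx [j == i]eq_sym (negPf nij) subr0 sub0r rmorphN !rmorph1 uij big1; first by ring.
by move=> k /andP[]; rewrite -!val_eqE /= => /negPf -> /negPf ->; rewrite subrr rmorph0 mul0r.
Qed.

(** Two words of equal sum give a rational relation whose coefficients are the differences of
    multiplicities. *)
Lemma indep_free n u : indep n u -> free_letters (mkseq u n).
Proof.
move=> ind m m' sm sm' eqs.
have uB : uniq (mkseq u n).
  rewrite map_inj_in_uniq ?iota_uniq // => i j; rewrite !mem_iota !add0n /=.
  exact: indep_inj.
have cnt x : x \in mkseq u n -> count_mem x m = count_mem x m'.
  case/mapP => i; rewrite mem_iota /= add0n => li ->.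
  pose c k : rat := (count_mem (u k) m)%:R - (count_mem (u k) m')%:R.
  have /(_ _ i li)/eqP := ind c; rewrite subr_eq0 eqr_nat => H; apply/eqP/H.
  move: eqs; rewrite !(sum_count uB) // !big_map => /eqP; rewrite -subr_eq0 -sumrB.
  rewrite -{1}[n]subn0 -/(index_iota 0 n) big_mkord => /eqP h.
  rewrite -[RHS]h; apply: eq_bigr => k _.
  by rewrite /c rmorphB /= !ratr_nat mulrBl.
apply/allP => x _ /=; apply/eqP.
case: (boolP (x \in mkseq u n)) => [/cnt //|xB].
by rewrite !(count_memPn _) //; apply: contra xB; [apply: sm'|apply: sm].
Qed.

(** The product of the denominators of the first [n] coefficients serves as common denominator. *)
Lemma rat_scale n c : (forall i, 0 <= c i) ->
  exists2 D : nat, (0 < D)%N & forall i, (i < n)%N -> c i * D%:R \is a Num.nat.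
Proof.
move=> c0; elim: n => [|n [D D0 IH]]; first by exists 1%N.
have cn : c n * `|denq (c n)|%:R = `|numq (c n)|%:R.
  rewrite !natr_absz !ger0_norm ?denq_ge0 ?numq_ge0 ?c0 //.
  by rewrite -{1}[c n]divq_num_den divfK // intr_eq0 denq_neq0.
exists (D * `|denq (c n)|)%N => [|i]; first by rewrite muln_gt0 D0 absz_gt0 denq_neq0.
rewrite ltnS leq_eqVlt => /predU1P[->|/IH cD].
  by rewrite natrM mulrCA cn -natrM natr_nat.
by rewrite natrM mulrA rpredM ?natr_nat.
Qed.

Lemma nat_scale n u (s : seq F) : (forall x, x \in s -> in_cone n u x) ->
  exists2 D : nat, (0 < D)%N & forall x, x \in s ->
    exists c : nat -> nat, x * D%:R = \sum_(i < n) (c i)%:R * u i.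
Proof.
elim: s => [_|a s IH cone]; first by exists 1%N.
have [x xs|D D0 hD] := IH; first by apply: cone; rewrite inE xs orbT.
have [|c c0 ac] := cone a; first by rewrite inE eqxx.
have [E E0 hE] := rat_scale n c0.
exists (D * E)%N => [|x]; first by rewrite muln_gt0 D0.
rewrite inE => /predU1P[->|/hD[e xe]].
  (* [Num.truncn] recovers the natural number that [c i * E%:R] is by the choice of [E]; the factor
     [D] brings it to the new common denominator. *)
  exists (fun i => Num.truncn (c i * E%:R) * D)%N; rewrite ac mulr_suml; apply: eq_bigr => i _.
  have /natrP[k ck] := hE i (ltn_ord i); rewrite ck natrK.
  rewrite mulrAC !natrM; congr (_ * _).
  have <- : ratr (c i) * E%:R = k%:R :> F by rewrite -!(ratr_nat F) -rmorphM ck.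
  by ring.
exists (fun i => e i * E)%N; rewrite natrM mulrA xe mulr_suml; apply: eq_bigr => i _.
by rewrite natrM mulrAC.
Qed.

(** Dividing a positive basis by one common denominator keeps it independent and makes the
    coefficients natural, that is, numbers of repetitions of letters. *)
Lemma free_words (s : seq F) : all (fun x => 0 < x) s ->
  exists B : seq F, [/\ free_letters B, all (fun x => 0 < x) B &
    forall x, x \in s -> exists2 w, {subset w <= B} & x = \sum_(y <- w) y].
Proof.
move=> /positive_basis[n [u [ind pos /nat_scale[D D0 cone]]]].
pose v i := u i / D%:R.
have D0' : 0 < D%:R :> F by rewrite ltr0n.
exists (mkseq v n); split.
- apply: indep_free => c; rewrite /lincomb => vc; apply: ind.
  rewrite -[RHS](mul0r D%:R) -vc mulr_suml; apply: eq_bigr => i _.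
  by rewrite /v mulrA divfK ?gt_eqF.
- by apply/allP => x /mapP[i]; rewrite mem_iota => /andP[_ /pos ui] ->; rewrite divr_gt0.
move=> x /cone[c xc].
exists (flatten [seq nseq (c i) (v i) | i <- iota 0 n]) => [y|].
  case/flatten_mapP => i li; rewrite mem_nseq => /andP[_ /eqP ->].
  by apply: map_f.
apply: (mulIf (x := D%:R)); rewrite ?gt_eqF // xc big_flatten big_map mulr_suml.
rewrite -[n in iota 0 n]subn0 -/(index_iota 0 n) big_mkord; apply: eq_bigr => i _.
by rewrite big_nseq iter_addr_0 [RHS]mulrnAl divfK ?gt_eqF // mulr_natl.
Qed.
End Basis.

(** * Subdivisions of an interval *)

Section Words.
Variable F : realFieldType.
Implicit Types (w m u v : seq F) (a b p c q s l x y : F) (f g : F -> F).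

Definition wlen w := \sum_(x <- w) x.

(** A word lists the successive lengths of a subdivided interval; its cuts are the endpoints,
    measured from the left end. *)
Definition is_cut w x := exists k, x = wlen (take k w).

Lemma wlen_cat u v : wlen (u ++ v) = wlen u + wlen v.
Proof. exact: big_cat. Qed.

Lemma wlen_cons x w : wlen (x :: w) = x + wlen w.
Proof. exact: big_cons. Qed.

Lemma wlen_nil : wlen [::] = 0.
Proof. exact: big_nil. Qed.

Definition pos_word w := all (fun x => 0 < x) w.

Lemma wlen_ge0 w : pos_word w -> 0 <= wlen w.
Proof.
elim: w => [|x w IH /= /andP[x0 /IH w0]]; first by rewrite wlen_nil.
by rewrite wlen_cons addr_ge0 // ltW.
Qed.

(** The words of consecutive gaps are concatenated; each point of the path is reached where the word
    of the preceding gap ends. *)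
Lemma path_word (B : seq F) xs x :
  (forall y, y \in pairmap (fun a b => b - a) x xs -> exists2 w, {subset w <= B} & y = wlen w) ->
  exists w, [/\ {subset w <= B}, wlen w = last x xs - x &
    forall y, y \in x :: xs -> is_cut w (y - x)].
Proof.
elim: xs x => [|z xs IH] x /= hw.
  exists [::]; split=> [//||y]; first by rewrite wlen_nil subrr.
  by rewrite inE => /eqP ->; exists 0%N; rewrite subrr wlen_nil.
have [y yxs|w [wB wl wc]] := IH z; first by apply: hw; rewrite inE yxs orbT.
have [|w0 w0B zx] := hw (z - x); first by rewrite inE eqxx.
exists (w0 ++ w); split=> [y||y].
- by rewrite mem_cat => /orP[/w0B|/wB].
- by rewrite wlen_cat wl -zx; ring.
rewrite inE => /predU1P[->|/wc[k yk]].
  by exists 0%N; rewrite take0 wlen_nil subrr.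
exists (size w0 + k)%N; rewrite takeD take_size_cat // drop_size_cat // wlen_cat -yk -zx.
by ring.
Qed.

Lemma free_grid (X : seq F) : (forall x, x \in X -> 0 <= x <= 1) ->
  exists w, [/\ pos_word w, wlen w = 1, free_letters w & forall x, x \in X -> is_cut w x].
Proof.
(* The sorted interior points are distinct and lie strictly between 0 and 1, so starting from 0 and
   appending 1 makes every gap positive. *)
move=> X01; pose t := sort <=%R (undup [seq x <- X | 0 < x < 1]); pose xs := rcons t 1.
have tX x : (x \in t) = (0 < x < 1) && (x \in X) by rewrite mem_sort mem_undup mem_filter.
have xs_path : path <%R 0 xs.
  rewrite rcons_path path_min_sorted; last by apply/allP => x; rewrite tX => /andP[/andP[]].
  rewrite lt_sorted_uniq_le sort_uniq undup_uniq sort_sorted /=; last exact: le_total.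
  by have := mem_last 0 t; rewrite inE => /predU1P[->|]; rewrite ?ltr01 // tX => /andP[/andP[]].
have gaps : all (fun x => 0 < x) (pairmap (fun a b => b - a) 0 xs).
  elim: xs {-2}0 xs_path => /= [|z xs' IH x /andP[xz /IH h]] //; apply/andP; split=> //.
  by rewrite subr_gt0.
have [B [fB pB hB]] := free_words gaps.
have [w [wB wl wc]] := path_word hB.
exists w; split.
- by apply/allP => x /wB /(allP pB).
- by rewrite wl last_rcons subr0.
- by move=> m m' mw mw'; apply: fB => x; [move/mw/wB|move/mw'/wB].
move=> x xX; rewrite -[x]subr0; apply: wc; rewrite inE mem_rcons inE tX xX andbT.
have /andP[x0 x1] := X01 x xX.
by move: x0 x1; rewrite !le_eqVlt eq_sym => /orP[->//|->] /orP[->|->]; rewrite ?orbT.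
Qed.

(** An interval is stored as its left endpoint and its length: a translation moves the first and
    preserves the second. *)
Fixpoint cells a w : seq (F * F) := if w is l :: w' then (a, l) :: cells (a + l) w' else [::].

Lemma cells_cat a u v : cells a (u ++ v) = cells a u ++ cells (a + wlen u) v.
Proof.
elim: u a => [|x u IH] a /=; first by rewrite wlen_nil addr0.
by rewrite IH wlen_cons addrA.
Qed.

Lemma cells_shift a b w s l : (s, l) \in cells a w -> (s + b, l) \in cells (a + b) w.
Proof.
elim: w a => //= x w IH a; rewrite !inE !xpair_eqE => /orP[/andP[/eqP -> /eqP ->]|/IH].
  by rewrite !eqxx.
by rewrite addrAC => ->; rewrite orbT.
Qed.

Lemma cells_bound a w s l : pos_word w -> (s, l) \in cells a w ->
  [/\ 0 < l, a <= s & s + l <= a + wlen w].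
Proof.
elim: w a => //= x w IH a /andP[x0 w0]; rewrite inE xpair_eqE wlen_cons.
move=> /orP[/andP[/eqP -> /eqP ->]|/(IH _ w0)[l0 h1 h2]].
  by have := wlen_ge0 w0; split=> //; lra.
by split=> //; lra.
Qed.

Lemma cells_cover a w x : a <= x < a + wlen w ->
  exists s l, (s, l) \in cells a w /\ s <= x < s + l.
Proof.
elim: w a => [|y w IH] a /=; first by rewrite wlen_nil; lra.
rewrite wlen_cons; case: (ltP x (a + y)) => h /andP[h1 h2].
  by exists a, y; rewrite inE eqxx h1.
have [|s [l [sl xs]]] := IH (a + y); first by lra.
by exists s, l; rewrite inE sl orbT.
Qed.

Lemma cells_inj a w s l s' l' x : pos_word w -> (s, l) \in cells a w ->
  (s', l') \in cells a w -> s <= x < s + l -> s' <= x < s' + l' -> s = s' /\ l = l'.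
Proof.
elim: w a => //= y w IH a /andP[y0 w0]; rewrite !inE !xpair_eqE.
move=> /orP[/andP[/eqP -> /eqP ->]|h] /orP[/andP[/eqP -> /eqP ->]|h'] // xs xs'.
- by have [] := cells_bound w0 h'; lra.
- by have [] := cells_bound w0 h; lra.
exact: IH h h' xs xs'.
Qed.

Lemma cut_segment w a b : pos_word w -> is_cut w a -> is_cut w b -> a < b ->
  exists u m v, [/\ w = u ++ m ++ v, wlen u = a & a + wlen m = b].
Proof.
move=> w0 [i ->] [j ->] lt_ij.
have lij : (i <= j)%N.
  rewrite leqNgt; apply: contraTN lt_ij => /ltnW ji; rewrite -leNgt.
  rewrite -(subnKC ji) takeD wlen_cat lerDl; apply: wlen_ge0.
  by apply/allP => x /mem_take /mem_drop /(allP w0).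
exists (take i w), (take (j - i) (drop i w)), (drop j w); split=> //.
  have -> : drop j w = drop (j - i) (drop i w) by rewrite drop_drop subnK.
  by rewrite !cat_take_drop.
by rewrite -wlen_cat -takeD subnKC.
Qed.

Lemma cells_segment u m v s l x : pos_word (u ++ m ++ v) ->
  (s, l) \in cells 0 (u ++ m ++ v) -> s <= x < s + l -> wlen u <= x < wlen u + wlen m ->
  (s, l) \in cells (wlen u) m.
Proof.
rewrite /pos_word !all_cat => /and3P[u0 m0 v0].
rewrite !cells_cat !mem_cat add0r => /or3P[h|//|h] xs xm.
  by have [] := cells_bound u0 h; lra.
by have [] := cells_bound v0 h; lra.
Qed.

(** * Interval exchanges as products of rotations *)

Definition rot p c q x :=
  if p <= x < c then x + (q - c) else if c <= x < q then x - (c - p) else x.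

(** Both exchanged intervals are required to be nonempty, so that each factor lifts to a restricted
    shuffle. *)
Inductive iet a b : (F -> F) -> Prop :=
| iet_id : iet a b id
| iet_rot p c q f : a <= p -> p < c -> c < q -> q <= b -> iet a b f ->
    iet a b (fun x => rot p c q (f x)).

Lemma iet_comp a b f g : iet a b f -> iet a b g -> iet a b (fun x => f (g x)).
Proof.
move=> hf hg; elim: hf => [|p c q f' ap pc cq qb _ IH]; first exact: hg.
exact: iet_rot IH.
Qed.

Lemma iet_widen a b a' b' f : a' <= a -> b <= b' -> iet a b f -> iet a' b' f.
Proof.
move=> aa bb; elim=> [|p c q f' ap pc cq qb _ IH]; first exact: iet_id.
by apply: iet_rot IH => //; lra.
Qed.

Lemma iet_out a b f x : iet a b f -> ~~ (a <= x < b) -> f x = x.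
Proof.
move=> hf out; elim: hf => // p c q f' ap pc cq qb _ ->.
by rewrite /rot !ifF //; apply: contraNF out; lra.
Qed.

Lemma iet_in a b f x : iet a b f -> a <= x < b -> a <= f x < b.
Proof.
move=> hf xab; elim: hf => // p c q f' ap pc cq qb _ IH.
by rewrite /rot; case: ifP => h1; [|case: ifP => h2]; lra.
Qed.

(** Degenerate rotations are the identity; admitting them spares case distinctions when an exchanged
    block is empty. *)
Lemma iet_rot_weak a b p c q : a <= p -> p <= c -> c <= q -> q <= b -> iet a b (rot p c q).
Proof.
move=> ap; rewrite le_eqVlt => /predU1P[-> cq qb|pc].
  have -> : rot c c q = id; last exact: iet_id.
  by apply/funext => x; rewrite /rot /=; case: ifP => h1; [|case: ifP => h2]; lra.
rewrite le_eqVlt => /predU1P[-> qb|cq qb]; last first.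
  by apply: (iet_rot (f := id)) => //; exact: iet_id.
have -> : rot p q q = id; last exact: iet_id.
by apply/funext => x; rewrite /rot /=; case: ifP => h1; [|case: ifP => h2]; lra.
Qed.

(** Selection sort along [w']: one rotation brings the first letter of [w'] to the front, and the
    induction hypothesis arranges the other letters to its right. *)
Lemma perm_iet w w' a : pos_word w -> perm_eq w w' ->
  exists2 f, iet a (a + wlen w) f & forall s l, (s, l) \in cells a w ->
    exists2 s', (s', l) \in cells a w' & forall x, s <= x < s + l -> f x = x - s + s'.
Proof.
elim: w' w a => [|y v' IH] w a w0 pw.
  by exists id; [exact: iet_id|move=> s l; rewrite (perm_nilP pw)].
have yw : y \in w by rewrite (perm_mem pw) inE eqxx.
case/splitPr: yw w0 pw => u1 u2; rewrite /pos_word all_cat /= => /and3P[p1 y0 p2].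
rewrite perm_catC /= perm_cons perm_catC => pw.
have p12 : pos_word (u1 ++ u2) by rewrite /pos_word all_cat p1 p2.
have [f fi fc] := IH _ (a + y) p12 pw.
have u1_0 := wlen_ge0 p1; have u2_0 := wlen_ge0 p2.
pose g := rot a (a + wlen u1) (a + wlen u1 + y).
exists (fun x => f (g x)).
  apply: iet_comp; first by apply: iet_widen fi; rewrite ?wlen_cat ?wlen_cons; lra.
  by apply: iet_rot_weak; rewrite ?wlen_cat ?wlen_cons; lra.
move=> s l; rewrite cells_cat mem_cat /= inE xpair_eqE.
move=> /or3P[h|/andP[/eqP -> /eqP ->]|h].
- have [] := fc (s + y) l; first by rewrite cells_cat mem_cat (cells_shift _ h).
  move=> s' h' fs'; exists s' => [|x xs]; first by rewrite inE h' orbT.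
  have [l0 b1 b2] := cells_bound p1 h.
  have -> : g x = x + y.
    by rewrite /g /rot; case: ifP => h1; [|case: ifP => h2]; lra.
  by rewrite fs'; lra.
- exists a => [|x xs]; first by rewrite inE eqxx.
  have -> : g x = x - (a + wlen u1) + a.
    by rewrite /g /rot; case: ifP => h1; [|case: ifP => h2]; lra.
  (* The cell just brought to the front ends at [a + y], where the support of [f] begins. *)
  by apply: iet_out fi _; lra.
have [] := fc s l; first by rewrite cells_cat mem_cat addrAC h orbT.
move=> s' h' fs'; exists s' => [|x xs]; first by rewrite inE h' orbT.
have [l0 b1 b2] := cells_bound p2 h.
have -> : g x = x; last exact: fs'.
by rewrite /g /rot; case: ifP => h1; [|case: ifP => h2]; lra.
Qed.

Lemma exchange_iet p q l f : 0 < l -> p + l <= q ->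
  (forall x, p <= x < p + l -> f x = x - p + q) ->
  (forall x, q <= x < q + l -> f x = x - q + p) ->
  (forall x, ~~ (p <= x < p + l) -> ~~ (q <= x < q + l) -> f x = x) ->
  iet p (q + l) f.
Proof.
move=> l0 pq f1 f2 f3.
(* The first rotation sends the left cell to the far end and shifts the rest left by [l]; the second
   carries the other cell, now ending at [q], to the front and restores the middle. *)
have -> : f = fun x => rot p (p + (q - (p + l))) q (rot p (p + l) (q + l) x).
  apply/funext => x; case: (boolP (p <= x < p + l)) => h1.
    rewrite f1 // [rot p (p + l) _ _]/rot h1 /rot !ifF; lra.
  case: (boolP (q <= x < q + l)) => h2.
    rewrite f2 // [rot p (p + l) _ _]/rot (negPf h1) ifT; last by lra.
    by rewrite /rot; case: ifP => h3; [|case: ifP => h4]; lra.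
  rewrite f3 // [rot p (p + l) _ _]/rot (negPf h1).
  by case: ifP => h3; rewrite /rot; case: ifP => h4; try (case: ifP => h5); lra.
by apply: iet_comp; apply: iet_rot_weak; lra.
Qed.

(** A cut splits the word in two, and every cell comes from one of the two subwords. *)
Lemma cut_cell w y s l : pos_word w -> is_cut w y -> (s, l) \in cells 0 w ->
  s + l <= y \/ y <= s.
Proof.
move=> w0 [k ->]; have : pos_word (take k w ++ drop k w) by rewrite cat_take_drop.
rewrite /pos_word all_cat -{3}(cat_take_drop k w) => /andP[p1 p2].
rewrite cells_cat mem_cat add0r => /orP[h|h].
  by left; have [] := cells_bound p1 h; lra.
by right; have [] := cells_bound p2 h; lra.
Qed.

(** The words cut out on [a, b) and on its translate by [t] have the same total length, so freeness
    makes them permutations of each other and [perm_iet] rearranges the first into the second. The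
    point [x0] records that the cell meets [a, b); the whole cell then lies inside. *)
Lemma segment_iet w a b t : pos_word w -> free_letters w -> a < b ->
  is_cut w a -> is_cut w b -> is_cut w (a + t) -> is_cut w (b + t) ->
  exists2 f, iet a b f & forall s l x0, (s, l) \in cells 0 w -> s <= x0 < s + l ->
    a <= x0 < b -> exists2 s', (s', l) \in cells 0 w &
    forall x, s <= x < s + l -> a <= x < b /\ f x + t = x - s + s'.
Proof.
move=> w0 fw ab ca cb cat cbt.
have [u [m [v [wE ua mb]]]] := cut_segment w0 ca cb ab.
have [|u' [m' [v' [wE' ua' mb']]]] := cut_segment w0 cat cbt; first by lra.
have pm : pos_word m.
  by move: w0; rewrite wE /pos_word !all_cat => /and3P[].
have pmm : perm_eq m m'.
  apply: fw => [x xm|x xm|].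
  - by rewrite wE !mem_cat xm orbT.
  - by rewrite wE' !mem_cat xm orbT.
  rewrite -/(wlen m) -/(wlen m'); lra.
have [f fi fc] := perm_iet a pm pmm; rewrite mb in fi.
exists f => // s l x0; rewrite {1}wE => sl xs xab.
have sm : (s, l) \in cells a m.
  rewrite -ua; apply: cells_segment sl xs _; first by rewrite -wE.
  by rewrite ua mb.
have [s' sm' fs'] := fc s l sm; exists (s' + t).
  by rewrite wE' !cells_cat !mem_cat add0r ua' (cells_shift _ sm') orbT.
move=> x xs'; have [] := cells_bound pm sm; rewrite mb => l0 as_ sb; split; first by lra.
by rewrite fs' //; ring.
Qed.

Lemma size_cells a w : size (cells a w) = size w.
Proof. by elim: w a => //= x w IH a; rewrite IH. Qed.

Lemma cells_uniq a w : pos_word w -> uniq (cells a w).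
Proof.
elim: w a => //= x w IH a /andP[x0 w0]; rewrite IH // andbT; apply/negP => h.
by have [] := cells_bound w0 h; lra.
Qed.

End Words.

(** * Boxes and lifted interval exchanges *)

Section Boxes.
Variable d : nat.
Implicit Types (a b x y v : pt d) (i j : 'I_d) (f g h s : pt d -> pt d).

(** A Boolean form of [in_rect], so that maps can be defined by cases on it. *)
Definition boxb a b x := [forall i, a i <= x i < b i].

Lemma boxP a b x : reflect (in_rect a b x) (boxb a b x).
Proof.
apply: (iffP forallP) => h i; first by have /andP[/RleP ? /RltP] := h i.
by have [/RleP -> /RltP ->] := h i.
Qed.

Lemma cubeP x : reflect (in_cube x) (boxb (fun=> 0) (fun=> 1) x).
Proof. exact: boxP. Qed.

Definition in_unit a b := forall i, 0 <= a i /\ b i <= 1.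

Lemma in_unit_sub a b x : in_unit a b -> boxb a b x -> in_cube x.
Proof.
move=> ab /forallP xab; apply/cubeP/forallP => i.
by have := xab i; have := ab i; lra.
Qed.

Lemma sub_in_unit a b : proper_rect a b -> (forall x, in_rect a b x -> in_cube x) ->
  in_unit a b.
Proof.
move=> ab sub i.
have aP j : a j < b j by apply/RltP/ab.
have /sub/cubeP/forallP/(_ i) a01 : in_rect a b a.
  by apply/boxP/forallP => j; rewrite lexx aP.
split; first by have := a01; lra.
rewrite leNgt; apply/negP => b1.
(* If [b i > 1], this point of the rectangle has a coordinate equal to 1 and so lies outside the
   cube. *)
have /sub/cubeP/forallP/(_ i) : in_rect a b (fun j => if j == i then 1 else a j).
  apply/boxP/forallP => j; case: eqP => [->|_]; last by rewrite lexx aP.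
  by move: a01; lra.
by rewrite eqxx ltxx andbF.
Qed.

Definition upd x i (t : R) : pt d := fun j => if j == i then t else x j.

Lemma upd_same x i t : upd x i t i = t. Proof. by rewrite /upd eqxx. Qed.

Lemma upd_id x i : upd x i (x i) = x.
Proof. by apply/funext => j; rewrite /upd; case: eqP => // ->. Qed.

Lemma upd_upd x i t t' : upd (upd x i t) i t' = upd x i t'.
Proof. by apply/funext => j; rewrite /upd; case: eqP. Qed.

Lemma box_upd a b x i t : boxb a b x -> boxb a b (upd x i t) = (a i <= t < b i).
Proof.
move=> /forallP xab; apply/forallP/idP => [/(_ i)|ti j]; first by rewrite upd_same.
by rewrite /upd; case: eqP => [->|].
Qed.

Lemma box_upd2 a b x i p q : a i <= p -> q <= b i ->
  boxb (upd a i p) (upd b i q) x = boxb a b x && (p <= x i < q).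
Proof.
move=> ap qb; apply/forallP/andP => [h|[/forallP h xpq j]].
  have hi := h i; rewrite !upd_same in hi; split=> //; apply/forallP => j.
  by have := h j; rewrite /upd; case: eqP => // ->; lra.
by rewrite /upd; case: eqP => [->|].
Qed.

Definition lift1 a b i (f : R -> R) x := if boxb a b x then upd x i (f (x i)) else x.

Definition shuffle a b i c := lift1 a b i (rot (a i) c (b i)).

(** Restricted shuffles become lifts of a rotation in one coordinate, which reduces identities
    between them to one real variable. *)
Lemma restricted_shuffleP f : is_restricted_shuffle f <->
  exists a b i c, [/\ proper_rect a b, in_unit a b, a i < c < b i & f = shuffle a b i c].
Proof.
split=> [[a [b [i [c [ab [sub [[/RltP ac /RltP cb] /= [f1 [f2 f3]]]]]]]]]|].
  exists a, b, i, c; split=> //; [exact: sub_in_unit|by rewrite ac cb|].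
  apply/funext => x; rewrite /shuffle /lift1; case: ifPn => [xab|/boxP]; last exact: f3.
  have xi := forallP xab i.
  case: (ltP (x i) c) => xc.
    rewrite f1; last first.
      (* Writing [a] as [upd a i (a i)] gives both corners the form that [box_upd2] expects. *)
      apply/boxP; rewrite -/(upd b i c) -[a](upd_id _ i) box_upd2 ?lexx ?(ltW cb) //.
      by rewrite xab; lra.
    apply/funext => j; rewrite /vadd /evec /upd /rot.
    case: eqP => [->|_]; last by rewrite R0E RplusE addr0.
    by rewrite ifT ?RplusE ?RminusE //; lra.
  rewrite f2; last first.
    apply/boxP; rewrite -/(upd a i c) -[b](upd_id _ i) box_upd2 ?lexx ?(ltW ac) //.
    by rewrite xab; lra.
  apply/funext => j; rewrite /vadd /evec /upd /rot.
  case: eqP => [->|_]; last by rewrite R0E RplusE addr0.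
  by rewrite ifF ?ifT ?RplusE ?RminusE //; lra.
move=> [a [b [i [c [ab ab1 /andP[ac cb] ->]]]]]; exists a, b, i, c; split=> //.
split; first by move=> x /boxP; exact: in_unit_sub.
split; first by split; apply/RltP.
rewrite /= -/(upd a i c) -/(upd b i c); split; [|split] => x.
- move/boxP; rewrite -[a in boxb a](upd_id _ i) box_upd2 ?lexx ?(ltW cb) // => /andP[xab xi].
  rewrite /shuffle /lift1 xab; apply/funext => j.
  rewrite /vadd /evec /upd /rot; case: eqP => [->|_]; last by rewrite R0E RplusE addr0.
  by rewrite xi.
- move/boxP; rewrite -[b in boxb _ b](upd_id _ i) box_upd2 ?lexx ?(ltW ac) // => /andP[xab xi].
  rewrite /shuffle /lift1 xab; apply/funext => j.
  rewrite /vadd /evec /upd /rot; case: eqP => [->|_]; last by rewrite R0E RplusE addr0.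
  by rewrite xi ifF //; lra.
- by move/boxP/negPf; rewrite /shuffle /lift1 => ->.
Qed.

Lemma lift1_comp a b i (f g : R -> R) x :
  (forall t, a i <= t < b i -> a i <= g t < b i) ->
  lift1 a b i f (lift1 a b i g x) = lift1 a b i (f \o g) x.
Proof.
move=> hg; rewrite /lift1; case: (boolP (boxb a b x)) => [xab|/negPf ->//].
have xi := forallP xab i.
by rewrite box_upd // hg // upd_same upd_upd.
Qed.

Lemma lift1_id a b i (f : R -> R) :
  (forall t, a i <= t < b i -> f t = t) -> lift1 a b i f = id.
Proof.
move=> hf; apply/funext => x; rewrite /lift1; case: ifP => // /forallP/(_ i)/hf ->.
exact: upd_id.
Qed.

(** After the exchange the two halves meet at the reflected point [a i + b i - c], where the inverse
    has to cut. *)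
Lemma shuffleK a b i c : a i < c < b i ->
  cancel (shuffle a b i c) (shuffle a b i (a i + b i - c)).
Proof.
move=> cab x; rewrite /shuffle lift1_comp => [|t ht]; last first.
  by rewrite /rot; case: ifP => h1; [|case: ifP => h2]; lra.
rewrite lift1_id // => t ht /=.
rewrite [rot _ c _ t]/rot; case: ifP => h1; [|case: ifP => h2]; rewrite /rot.
- by case: ifP => h3; try (case: ifP => h4); lra.
- by case: ifP => h3; try (case: ifP => h4); lra.
- by lra.
Qed.

(** * The group generated by the restricted shuffles *)

Notation Gen := (generated (@is_restricted_shuffle d)).

Lemma shuffle_inv s : is_restricted_shuffle s ->
  exists t : pt d -> pt d, [/\ is_restricted_shuffle t, cancel s t & cancel t s].
Proof.
move=> /restricted_shuffleP[a [b [i [c [ab ab1 cab ->]]]]].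
exists (shuffle a b i (a i + b i - c)); split.
- by apply/restricted_shuffleP; exists a, b, i, (a i + b i - c); split=> //; lra.
- exact: shuffleK.
by rewrite -[c in X in cancel _ X](subKr (a i + b i)); apply: shuffleK; lra.
Qed.

Lemma shuffle_cube s x : is_restricted_shuffle s -> in_cube x -> in_cube (s x).
Proof.
move=> /restricted_shuffleP[a [b [i [c [ab ab1 cab ->]]]]] xc; rewrite /shuffle /lift1.
case: ifP => // xab; apply: (in_unit_sub ab1); rewrite box_upd //.
have := forallP xab i.
by rewrite /rot; case: ifP => h1; [|case: ifP => h2]; lra.
Qed.

Lemma shuffle_out s x : is_restricted_shuffle s -> ~ in_cube x -> s x = x.
Proof.
move=> /restricted_shuffleP[a [b [i [c [ab ab1 cab ->]]]]] xc; rewrite /shuffle /lift1.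
by case: ifP => // /(in_unit_sub ab1).
Qed.

Lemma gen_shuffle s : is_restricted_shuffle s -> Gen s.
Proof. by move=> hs; exact: (gen_mul hs (gen_id _)). Qed.

(** [gen_mul_inv] accepts any two-sided inverse; by uniqueness it is the shuffle given by
    [shuffle_inv]. *)
Lemma inv_shuffle s t : is_restricted_shuffle s -> cancel s t -> cancel t s ->
  is_restricted_shuffle t.
Proof.
move=> /shuffle_inv[t' [ht' st' t's]] st ts.
have -> : t = t'; last exact: ht'.
by apply/funext => x; rewrite -[x in LHS]t's st.
Qed.

Lemma gen_comp f g : Gen f -> Gen g -> Gen (fun x => f (g x)).
Proof.
move=> hf hg; elim: hf => [//|s f' hs _ IH|s t f' hs st ts _ IH]; first exact: gen_mul.
exact: (gen_mul_inv hs st ts IH).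
Qed.

Lemma gen_inv f : Gen f -> exists g, [/\ Gen g, cancel f g & cancel g f].
Proof.
elim=> [|s f' hs _ [g [hg fg gf]]|s t f' hs ts st _ [g [hg fg gf]]].
- by exists id; split=> //; exact: gen_id.
- have [t [ht st ts]] := shuffle_inv hs.
  exists (fun x => g (t x)); split=> [|x|x]; last by rewrite gf ts.
    exact: gen_comp (gen_shuffle ht).
  by rewrite st fg.
exists (fun x => g (s x)); split=> [|x|x]; last by rewrite gf st.
  exact: gen_comp (gen_shuffle hs).
by rewrite ts fg.
Qed.

Lemma gen_cube f x : Gen f -> in_cube x -> in_cube (f x).
Proof.
move=> hf xc; elim: hf => [//|s f' hs _|s t f' hs st ts _]; first exact: shuffle_cube.
exact: (shuffle_cube (inv_shuffle hs ts st)).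
Qed.

Lemma gen_out f x : Gen f -> ~ in_cube x -> f x = x.
Proof.
move=> hf xc; elim: hf => [//|s f' hs _ ->|s t f' hs st ts _ ->]; first exact: shuffle_out.
exact: (shuffle_out (inv_shuffle hs ts st)).
Qed.

(** Each rotation of [p, q) lifts to the shuffle of the box whose side in direction [i] is narrowed
    to [p, q). *)
Lemma lift1_gen a b i (f : R -> R) : proper_rect a b -> in_unit a b ->
  iet (a i) (b i) f -> Gen (lift1 a b i f).
Proof.
move=> ab ab1; elim=> [|p c q g ap pc cq qb hg IH].
  by rewrite lift1_id //; exact: gen_id.
have -> : lift1 a b i (fun t => rot p c q (g t)) =
    (fun x => shuffle (upd a i p) (upd b i q) i c (lift1 a b i g x)).
  apply/funext => x; rewrite /shuffle !upd_same {2}/lift1 box_upd2 // /lift1.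
  case: ifP => [xab|->//]; have gi := iet_in hg (forallP xab i).
  rewrite box_upd // gi upd_same upd_upd /=; case: ifP => // out.
  by rewrite /rot !ifF //; lra.
apply: gen_mul => //; apply/restricted_shuffleP.
exists (upd a i p), (upd b i q), i, c; rewrite !upd_same; split=> //; last by lra.
  move=> j; apply/RltP; rewrite /upd; case: eqP => _; last exact/RltP/ab.
  by lra.
move=> j; have := ab1 j; rewrite /upd; case: eqP => [->|]; lra.
Qed.

Definition lift a b (f : 'I_d -> R -> R) x : pt d :=
  if boxb a b x then fun i => f i (x i) else x.

Lemma lift_gen a b (f : 'I_d -> R -> R) : proper_rect a b -> in_unit a b ->
  (forall i, iet (a i) (b i) (f i)) -> Gen (lift a b f).
Proof.
move=> ab ab1 hf.
(* The coordinates are treated one at a time; [r] lists those already handled. *)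
suff H r : uniq r -> Gen (lift a b (fun i => if i \in r then f i else id)).
  have -> : f = fun i => if i \in enum 'I_d then f i else id.
    by apply/funext => i; rewrite mem_enum.
  exact/H/enum_uniq.
elim: r => [_|i r IH /= /andP[ir /IH hr]].
  have -> : lift a b (fun i => if i \in [::] then f i else id) = id.
    by apply/funext => x; rewrite /lift; case: ifP => // _; apply/funext.
  exact: gen_id.
have -> : lift a b (fun j => if j \in i :: r then f j else id) =
    fun x => lift1 a b i (f i) (lift a b (fun j => if j \in r then f j else id) x).
  apply/funext => x; rewrite /lift1 /lift; case: ifP => [xab|->//].
  have -> : boxb a b (fun j => (if j \in r then f j else id) (x j)).
    apply/forallP => j; have xj := forallP xab j.
    by case: ifP => _ //; apply: iet_in.
  apply/funext => j; rewrite /upd inE (negPf ir).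
  by case: eqP => [->|].
by apply: gen_comp => //; apply: lift1_gen.
Qed.

End Boxes.

(** * Permutations of the cells of a grid *)

Section Grid.
Variables (d : nat) (w : seq R).
Hypotheses (w_pos : pos_word w) (w_len : wlen w = 1).
Notation Gen := (generated (@is_restricted_shuffle d)).
Notation K := {ffun 'I_d -> 'I_(size w)}.
Implicit Types (k q : K) (x y : pt d) (i j : 'I_d) (f g h : pt d -> pt d).

(** A multi-index picks one interval in each direction. The default of [nth] is never reached, since
    [k i] is below [size w]. *)
Definition corner k : pt d := fun i => (nth (0, 0) (cells 0 w) (k i)).1.
Definition side k : pt d := fun i => (nth (0, 0) (cells 0 w) (k i)).2.
Definition incell k x := boxb (corner k) (fun i => corner k i + side k i) x.

Lemma mem_cell k i : (corner k i, side k i) \in cells 0 w.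
Proof. by rewrite -surjective_pairing mem_nth // size_cells. Qed.

Lemma cell_bound k i : [/\ 0 < side k i, 0 <= corner k i & corner k i + side k i <= 1].
Proof. by have := cells_bound w_pos (mem_cell k i); rewrite add0r w_len. Qed.

Lemma cell_of (s l : pt d) : (forall i, (s i, l i) \in cells 0 w) ->
  exists k, corner k = s /\ side k = l.
Proof.
move=> sl; have lt i : (index (s i, l i) (cells 0 w) < size w)%N.
  by rewrite -(size_cells 0 w) index_mem.
by exists [ffun i => Ordinal (lt i)]; split; apply/funext => i;
  rewrite /corner /side ffunE /= nth_index.
Qed.

Lemma incell_corner k : incell k (corner k).
Proof. by apply/forallP => i; have [] := cell_bound k i; lra. Qed.

Lemma incell_cube k x : incell k x -> in_cube x.
Proof. by apply: in_unit_sub => i; have [] := cell_bound k i. Qed.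

Lemma cube_incell x : in_cube x -> exists k, incell k x.
Proof.
move=> /cubeP/forallP xc.
have /choice[sl hsl] : forall i, exists sl, sl \in cells 0 w /\ sl.1 <= x i < sl.1 + sl.2.
  move=> i; have [|s [l []]] := cells_cover (a := 0) (w := w) (x := x i).
    by rewrite add0r w_len.
  by exists (s, l).
have [|k [ks kl]] := @cell_of (fun i => (sl i).1) (fun i => (sl i).2).
  by move=> i; rewrite -surjective_pairing; have [] := hsl i.
by exists k; apply/forallP => i; rewrite ks kl; have [] := hsl i.
Qed.

Lemma index_inj k q i : corner k i = corner q i -> side k i = side q i -> k i = q i.
Proof.
move=> ci si; apply/val_inj/eqP.
rewrite -(nth_uniq (0, 0) _ _ (cells_uniq 0 w_pos)) ?size_cells; [|exact: ltn_ord..].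
rewrite [nth _ _ (k i)]surjective_pairing [nth _ _ (q i)]surjective_pairing.
by apply/eqP; congr (_, _).
Qed.

Lemma incell_inj k q x : incell k x -> incell q x -> k = q.
Proof.
move=> /forallP kx /forallP qx; apply/ffunP => i.
have [ci si] := cells_inj w_pos (mem_cell k i) (mem_cell q i) (kx i) (qx i).
exact: index_inj.
Qed.

(** The map induced by a map of cell indices: each cell is translated so that corners go to corners,
    and points in no cell stay fixed. *)
Definition act (r : K -> K) x : pt d :=
  if [pick k | incell k x] is Some k then fun i => x i - corner k i + corner (r k) i else x.

Lemma actE r k x : incell k x -> act r x = fun i => x i - corner k i + corner (r k) i.
Proof.
move=> kx; rewrite /act; case: pickP => [q /(incell_inj kx) <- //|/(_ k)].
by rewrite kx.
Qed.

Lemma act_out r x : ~ in_cube x -> act r x = x.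
Proof. by move=> xc; rewrite /act; case: pickP => // k /incell_cube. Qed.

(** Preservation of shapes, which makes the translate of a cell exactly the target cell. *)
Definition typed (r : K -> K) := forall k, side (r k) = side k.

Lemma act_incell r k x : typed r -> incell k x -> incell (r k) (act r x).
Proof.
move=> tr kx; rewrite (actE r kx); apply/forallP => i.
by have := forallP kx i; rewrite tr; lra.
Qed.

Lemma act_comp r r' : typed r' -> act (r \o r') = fun x => act r (act r' x).
Proof.
move=> tr; apply/funext => x; case: (pselect (in_cube x)) => [/cube_incell[k kx]|xc].
  rewrite (actE r (act_incell tr kx)) (actE _ kx) (actE _ kx).
  by apply/funext => i /=; rewrite addrK.
by rewrite !act_out // (act_out _ xc).
Qed.

Lemma typed_tperm k q : side k = side q -> typed (tperm k q).
Proof. by move=> kq p; case: tpermP => // ->. Qed.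

Lemma act_id : act id = id.
Proof.
apply/funext => x; rewrite /act; case: pickP => // k _.
by apply/funext => i; rewrite subrK.
Qed.

(* Cells which differ in one coordinate only lie in a common bar, inside which two
   restricted shuffles exchange them. *)
Lemma act_tperm1 k q i : side k = side q -> (forall j, j != i -> k j = q j) ->
  corner k i < corner q i -> Gen (act (tperm k q)).
Proof.
move=> kq same lt_kq.
have csame j : j != i -> corner k j = corner q j by rewrite /corner => /same ->.
(* Overlapping intervals of one subdivision would coincide, against [lt_kq]. *)
have lei : corner k i + side k i <= corner q i.
  rewrite leNgt; apply/negP => lt.
  have [] : corner k i = corner q i /\ side k i = side q i; last by lra.
  apply: (cells_inj (x := corner q i) w_pos (mem_cell k i) (mem_cell q i)).
    by rewrite lt ltW.
  by have [] := cell_bound q i; lra.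
have si : side q i = side k i by rewrite kq.
(* The bar runs from the lower corner of [k] to the upper corner of [q]; [e] is the exchange of the
   two cells seen in direction [i]. *)
pose b j := corner q j + side q j.
pose e (t : R) := if corner k i <= t < corner k i + side k i then t - corner k i + corner q i
  else if corner q i <= t < corner q i + side q i then t - corner q i + corner k i else t.
have qi : forall x, incell k x = boxb (corner k) b x &&
    (corner k i <= x i < corner k i + side k i).
  move=> x; apply/forallP/andP => [h|[/forallP h xi] j].
    split=> //; apply/forallP => j; have := h j; rewrite /b.
    by have [->|/csame ->] := eqVneq j i; [lra|rewrite kq].
  by have := h j; rewrite /b; have [->|/csame ->] := eqVneq j i; [lra|rewrite kq].
have qj : forall x, incell q x = boxb (corner k) b x &&
    (corner q i <= x i < corner q i + side q i).
  move=> x; apply/forallP/andP => [h|[/forallP h xi] j].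
    split=> //; apply/forallP => j; have := h j; rewrite /b.
    by have [->|/csame ->] := eqVneq j i; [lra|].
  by have := h j; rewrite /b; have [->|/csame ->] := eqVneq j i; [lra|].
have -> : act (tperm k q) = lift1 (corner k) b i e.
  apply/funext => x; rewrite /lift1.
  case: (boolP (incell k x)) => kx.
    rewrite (actE _ kx) tpermL; move: kx; rewrite qi => /andP[-> xi].
    apply/funext => j; rewrite /upd /e xi.
    by have [->//|/csame ->] := eqVneq j i; rewrite subrK.
  case: (boolP (incell q x)) => qx.
    rewrite (actE _ qx) tpermR; move: qx; rewrite qj => /andP[-> xi].
    have -> : e (x i) = x i - corner q i + corner k i by rewrite /e ifF ?xi //; lra.
    by apply/funext => j; rewrite /upd; have [->//|/csame ->] := eqVneq j i; rewrite subrK.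
  have -> : (if boxb (corner k) b x then upd x i (e (x i)) else x) = x.
    case: ifP => // xb; move: kx qx; rewrite qi qj xb /= /e => /negPf -> /negPf ->.
    exact: upd_id.
  rewrite /act; case: pickP => // p px; apply/funext => j.
  rewrite tpermD ?subrK //; first by apply: contraNneq kx => ->.
  by apply: contraNneq qx => ->.
apply: lift1_gen.
- move=> j; apply/RltP; rewrite /b; have [k0 k1 k2] := cell_bound k j.
  by case: (eqVneq j i) k0 k1 k2 => [->|/csame <-]; rewrite -kq; lra.
- move=> j; rewrite /b; have [k0 k1 k2] := cell_bound k j.
  by have [q0 q1 q2] := cell_bound q j.
rewrite /b si; apply: exchange_iet => //; first by have [] := cell_bound k i.
- by move=> t ht; rewrite /e ht.
- by move=> t ht; rewrite /e ifF ?si ?ht //; lra.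
- by move=> t /negPf h1 /negPf h2; rewrite /e si h1 h2.
Qed.

(** The product of permutations applies its left factor first, so shapes must be preserved by
    [s]. *)
Lemma act_perm_comp (s t : {perm K}) : typed s -> Gen (act s) -> Gen (act t) ->
  Gen (act (s * t)%g).
Proof.
move=> ts gs gt; have -> : act (s * t)%g = act (t \o s).
  by congr act; apply/funext => k; rewrite permM.
by rewrite act_comp //; exact: gen_comp.
Qed.

(** Induction on the number of coordinates where [k] and [q] differ. An intermediate cell [p] takes
    one such coordinate from [q], and the transposition of [k] and [q] is that of [p] and [q]
    conjugated by that of [k] and [p]. *)
Lemma act_tperm k q : side k = side q -> Gen (act (tperm k q)).
Proof.
have one k' q' i : side k' = side q' -> (forall j, j != i -> k' j = q' j) -> k' i != q' i ->
    Gen (act (tperm k' q')).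
  move=> kq same ni; have : corner k' i != corner q' i.
    by apply: contraNneq ni => ci; apply/eqP; apply: index_inj; rewrite ?kq.
  rewrite neq_lt => /orP[] lt; first exact: act_tperm1 lt.
  by rewrite tpermC; apply: act_tperm1 lt => // j /same.
have [m] := ubnP #|[set i | k i != q i]|.
elim: m k => // m IH k; rewrite ltnS => le_m kq.
have [->|/eqP nkq] := eqVneq k q.
  have -> : act (tperm q q) = id; last exact: gen_id.
  by rewrite tperm1 -act_id; congr act; apply/funext => p; rewrite perm1.
have [i ni] : exists i, k i != q i.
  apply: contrapT => /forallNP h; apply: nkq; apply/ffunP => i.
  by have /negP := h i; rewrite negbK => /eqP.
pose p : K := [ffun j => if j == i then q j else k j].
have pE j : p j = if j == i then q j else k j by rewrite ffunE.
have ps : side p = side k.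
  apply/funext => j; rewrite /side pE; case: eqP => // _.
  by rewrite -/(side q j) -kq.
have kp : Gen (act (tperm k p)).
  apply: (one _ _ i) => [//|j nj|]; first by rewrite pE (negPf nj).
  by rewrite pE eqxx.
have [<-//|npq] := eqVneq p q.
have pq : Gen (act (tperm p q)).
  apply: IH; last by rewrite ps.
  apply: leq_trans le_m; apply: proper_card; apply/properP; split.
    by apply/subsetP => j; rewrite !inE pE; have [_|//] := eqVneq j i; rewrite eqxx.
  by exists i; rewrite !inE ?pE ?eqxx.
have kpp : k != p by apply: contraNneq ni => kpE; rewrite kpE pE eqxx.
have -> : tperm k q = (tperm k p * (tperm p q * tperm k p))%g.
  have <- : (tperm p q ^ tperm k p)%g = tperm k q.
    by rewrite tpermJ tpermR tpermD //; apply/eqP.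
  by rewrite conjgE tpermV.
by apply: act_perm_comp => //; [|apply: act_perm_comp => //];
  apply: typed_tperm; rewrite ?ps.
Qed.

(** Induction on the size of the support: following [s] by the transposition of [k] and [s k] fixes
    [k] and moves no fixed point of [s]. *)
Lemma act_perm (s : {perm K}) : typed s -> Gen (act s).
Proof.
have [m] := ubnP #|[set k | s k != k]|.
elim: m s => // m IH s; rewrite ltnS => le_m ts.
case: (pselect (exists k, s k != k)) => [[k nk]|nok]; last first.
  have -> : act s = id; last exact: gen_id.
  rewrite -act_id; congr act; apply/funext => k; apply/eqP/negPn/negP => nk.
  by apply: nok; exists k.
have kk : side (s k) = side k by apply: ts.
have -> : s = (s * tperm k (s k) * tperm k (s k))%g by rewrite -mulgA tperm2 mulg1.
have ts' : typed (s * tperm k (s k))%g.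
  by move=> q; rewrite permM typed_tperm // ts.
apply: act_perm_comp => //; last exact: act_tperm.
apply: IH => //; apply: leq_trans le_m; apply: proper_card; apply/properP; split.
  apply/subsetP => q; rewrite !inE permM; apply: contraNneq => sq; rewrite sq.
  have kq : k != q by apply: contraNneq nk => ->; rewrite sq.
  by rewrite tpermD // -sq (inj_eq perm_inj).
by exists k; rewrite !inE // permM tpermR eqxx.
Qed.

(** The images of corners define a map of indices, injective because [f] is, hence a permutation of
    the finite set of cells. *)
Lemma gen_cell_map f : (forall x, ~ in_cube x -> f x = x) ->
  (forall x y, in_cube x -> in_cube y -> f x = f y -> x = y) ->
  (forall k, exists2 q, side q = side k &
     forall x, incell k x -> f x = fun i => x i - corner k i + corner q i) ->
  Gen f.
Proof.
move=> fout finj fcell.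
have /choice[r hr] : forall k, exists q, side q = side k /\
     forall x, incell k x -> f x = fun i => x i - corner k i + corner q i.
  by move=> k; have [q] := fcell k; exists q.
have fc k : f (corner k) = corner (r k).
  rewrite (hr k).2; last exact: incell_corner.
  by apply/funext => i; rewrite subrr add0r.
have rinj : injective r.
  move=> k q rkq; apply: (@incell_inj _ _ (corner k)); first exact: incell_corner.
  have -> : corner k = corner q; last exact: incell_corner.
  apply: finj; rewrite ?fc ?rkq //; apply: incell_cube; exact: incell_corner.
have -> : f = act (perm rinj).
  apply/funext => x; case: (pselect (in_cube x)) => [/cube_incell[k kx]|xc].
    by rewrite (actE _ kx) permE (hr k).2.
  by rewrite act_out ?fout.
by apply: act_perm => k; rewrite permE (hr k).1.
Qed.

(** The grid cells themselves form the required partition into rectangles. *)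
Lemma rec_cell_map f : (forall x, ~ in_cube x -> f x = x) ->
  (forall x, in_cube x -> in_cube (f x)) ->
  (forall x y, in_cube x -> in_cube y -> f x = f y -> x = y) ->
  (forall y, in_cube y -> exists x, in_cube x /\ f x = y) ->
  (forall k, exists v, forall x, incell k x -> f x = vadd x v) ->
  is_Rec f.
Proof.
move=> fout fcube finj fsurj /choice[v hv]; do 4![split=> //].
pose piece k := (corner k, fun i => corner k i + side k i, v k) : pt d * pt d * pt d.
(* The cell of the origin provides the default value for [nth]. *)
have [k0 _] : exists k, incell k (fun=> 0).
  by apply: cube_incell; apply/cubeP/forallP => i; lra.
exists [seq piece k | k <- enum K], (piece k0).
rewrite size_map; have pE (m : nat) : (m < size (enum K))%N ->
    nth (piece k0) [seq piece k | k <- enum K] m = piece (nth k0 (enum K) m).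
  exact: nth_map.
split=> [j hj i|].
  by rewrite pE //=; apply/RltP; have [] := cell_bound (nth k0 (enum K) j) i; lra.
split=> [j x hj|]; first by rewrite pE //= => /boxP; exact: incell_cube.
split=> [x /cube_incell[k kx]|].
  have hk : (index k (enum K) < size (enum K))%N by rewrite index_mem mem_enum.
  by exists (index k (enum K)); rewrite pE // nth_index ?mem_enum //; split=> //; apply/boxP.
split=> [j l x hj hl njl|j x hj]; rewrite !pE //=.
  move=> [/boxP h /boxP h']; apply: njl; apply/eqP.
  rewrite -(nth_uniq k0 hj hl (enum_uniq _)); apply/eqP; exact: incell_inj h h'.
by move/boxP; exact: hv.
Qed.

(** [segment_iet] is applied in every direction and lifted to the box: after the rearrangement [g],
    translation by [v] carries each cell of the piece to a cell of the same shape. *)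
Lemma piece_gen (a b v : pt d) : free_letters w -> proper_rect a b -> in_unit a b ->
  (forall i, [/\ is_cut w (a i), is_cut w (b i), is_cut w (a i + v i) & is_cut w (b i + v i)]) ->
  exists g, [/\ Gen g, forall x, ~~ boxb a b x -> g x = x, forall x, boxb a b x -> boxb a b (g x)
   & forall k x0, incell k x0 -> boxb a b x0 -> exists2 q, side q = side k &
     forall x, incell k x -> boxb a b x /\ vadd (g x) v = fun i => x i - corner k i + corner q i].
Proof.
move=> fw ab ab1 cuts.
have /choice[e he] : forall i, exists e, iet (a i) (b i) e /\
    forall s l (x0 : R), (s, l) \in cells 0 w -> s <= x0 < s + l ->
    a i <= x0 < b i -> exists2 s', (s', l) \in cells 0 w &
    forall x : R, s <= x < s + l -> a i <= x < b i /\ e x + v i = x - s + s'.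
  move=> i; have [c1 c2 c3 c4] := cuts i.
  have abi : a i < b i by apply/RltP/ab.
  by have [e] := segment_iet w_pos fw abi c1 c2 c3 c4; exists e.
exists (lift a b e); split.
- by apply: lift_gen => // i; have [] := he i.
- by move=> x /negPf xb; rewrite /lift xb.
- move=> x xb; rewrite /lift xb; apply/forallP => i.
  by apply: iet_in (forallP xb i); have [] := he i.
move=> k x0 /forallP kx0 /forallP bx0.
have /choice[s hs] : forall i, exists s, (s, side k i) \in cells 0 w /\
    forall x : R, corner k i <= x < corner k i + side k i ->
      a i <= x < b i /\ e i x + v i = x - corner k i + s.
  move=> i; have [_ H] := he i.
  by have [s] := H _ _ _ (mem_cell k i) (kx0 i) (bx0 i); exists s.
have [|q [qs ql]] := @cell_of s (side k); first by move=> i; have [] := hs i.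
exists q => // x /forallP kx.
have xb : boxb a b x by apply/forallP => i; have [_ /(_ _ (kx i))[]] := hs i.
split=> //; apply/funext => i; rewrite /vadd /lift xb qs RplusE.
by have [_ /(_ _ (kx i))[]] := hs i.
Qed.

End Grid.

(** * Membership of the shuffles in the group, and generation by them *)

Section Main.
Variable d : nat.
Notation Gen := (generated (@is_restricted_shuffle d)).

(** In a grid that has [c] and all coordinates of [a] and [b] among its cuts, the case in the
    definition of the shuffle is constant on each cell. *)
Lemma shuffle_rec s : is_restricted_shuffle s -> @is_Rec d s.
Proof.
move=> hs; have [t [ht st ts]] := shuffle_inv hs.
have := hs; move=> /restricted_shuffleP[a [b [i [c [ab ab1 cab sE]]]]].
pose X := c :: [seq a j | j : 'I_d] ++ [seq b j | j : 'I_d].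
have [x|w [w0 w1 _ wX]] := @free_grid _ X.
  have abP j : 0 <= a j <= 1 /\ 0 <= b j <= 1.
    by have := ab1 j; have /RltP := ab j; lra.
  rewrite inE mem_cat => /or3P[/eqP ->|/mapP[j _ ->]|/mapP[j _ ->]]; try by have [] := abP j.
  by have := abP i; lra.
(* No cut is interior to a cell, so a point and the corner of its cell compare in the same way with
   it. *)
have cutE y k (j : 'I_d) x : y \in X -> incell (w := w) k x -> (y <= x j) = (y <= corner k j).
  move=> /wX yc /forallP/(_ j) kx.
  by have [] := cut_cell w0 yc (mem_cell k j); move: kx; lra.
have cutE' y k (j : 'I_d) x : y \in X -> incell (w := w) k x -> (x j < y) = (corner k j < y).
  by move=> yX kx; rewrite !ltNge (cutE y k j x).
have aX j : a j \in X by rewrite inE mem_cat map_f ?orbT // mem_enum.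
have bX j : b j \in X by rewrite inE mem_cat (map_f b) ?orbT // mem_enum.
have cX : c \in X by rewrite inE eqxx.
apply: (rec_cell_map w0 w1).
- by move=> x; exact: shuffle_out.
- by move=> x; exact: shuffle_cube.
- by move=> x y _ _; exact: (can_inj st).
- by move=> y yc; exists (t y); rewrite ts; split=> //; exact: shuffle_cube.
(* The translation vector is read off at the corner of the cell. *)
move=> k; exists (fun j => s (corner k) j - corner k j) => x kx; rewrite sE /shuffle /lift1.
have -> : boxb a b x = boxb a b (corner k).
  by apply: eq_forallb => j; rewrite (cutE _ k) // (cutE' _ k).
apply/funext => j; rewrite /vadd RplusE; case: ifP => _; last by rewrite subrr addr0.
rewrite /upd; case: eqP => [->|_]; last by rewrite subrr addr0.
rewrite /rot !(cutE _ k i x) // !(cutE' _ k i x) //.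
by case: ifP => _; [|case: ifP => _]; ring.
Qed.

Lemma rec_gen f : @is_Rec d f -> Gen f.
Proof.
move=> [fout [fcube [finj [fsurj [s [p0 [prop [sub [cov [disj tr]]]]]]]]]].
pose a j := (nth p0 s j).1.1; pose b j := (nth p0 s j).1.2; pose v j := (nth p0 s j).2.
pose X := flatten [seq flatten [seq [:: a j i; b j i; a j i + v j i; b j i + v j i]
  | i <- enum 'I_d] | j <- iota 0 (size s)].
have ab1 j : (j < size s)%N -> in_unit (a j) (b j).
  by move=> hj; apply: sub_in_unit => [|x]; [exact: prop|exact: sub].
(* The translate of a piece is its image under [f], which stays in the cube. *)
have abv1 j : (j < size s)%N -> in_unit (vadd (a j) (v j)) (vadd (b j) (v j)).
  move=> hj; apply: sub_in_unit => [i|x /boxP/forallP xj].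
    by apply/RltP; have /RltP := prop j hj i; rewrite /vadd !RplusE ltrD2r.
  pose y : pt d := fun i => x i - v j i.
  have yj : in_rect (a j) (b j) y.
    by apply/boxP/forallP => i; have := xj i; rewrite /vadd !RplusE /y; lra.
  have -> : x = f y by rewrite (tr j) //; apply/funext => i; rewrite /vadd RplusE subrK.
  exact/fcube/(sub j).
have [x|w [w0 w1 wf wX]] := @free_grid _ X.
  case/flatten_mapP => j; rewrite mem_iota => /andP[_ hj] /flatten_mapP[i _].
  have [a0 b1] := ab1 j hj i; have [] := abv1 j hj i; rewrite /vadd !RplusE => av bv.
  have /RltP abji := prop j hj i; rewrite -/(a j) -/(b j) in abji.
  by rewrite !inE => /or4P[] /eqP ->; lra.
have cuts j : (j < size s)%N -> forall i, [/\ is_cut w (a j i), is_cut w (b j i),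
    is_cut w (a j i + v j i) & is_cut w (b j i + v j i)].
  move=> hj i; have XE x : x \in [:: a j i; b j i; a j i + v j i; b j i + v j i] -> is_cut w x.
    move=> xE; apply: wX; apply/flatten_mapP; exists j; first by rewrite mem_iota.
    by apply/flatten_mapP; exists i => //; rewrite mem_enum.
  by split; apply: XE; rewrite !inE eqxx ?orbT.
(* The rearrangements of the single pieces are composed one after another; since the pieces are
   disjoint, none disturbs the others. *)
have step n : (n <= size s)%N -> exists h, [/\ Gen h,
    forall x, (forall j, (j < n)%N -> ~~ boxb (a j) (b j) x) -> h x = x &
    forall j, (j < n)%N -> (forall x, boxb (a j) (b j) x -> boxb (a j) (b j) (h x)) /\
    forall k x0, incell (w := w) k x0 -> boxb (a j) (b j) x0 ->
      exists2 q : {ffun 'I_d -> 'I_(size w)}, side q = side k &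
      forall x, incell k x -> boxb (a j) (b j) x /\
        vadd (h x) (v j) = fun i => x i - corner k i + corner q i].
  elim: n => [_|n IH ltn].
    by exists id; split=> //; exact: gen_id.
  have [h [hg hout hin]] := IH (ltnW ltn).
  have [g [gg gout gin gcell]] := piece_gen w0 wf (prop n ltn) (ab1 n ltn) (cuts n ltn).
  exists (fun x => g (h x)); split=> [|x xout|j].
  - exact: gen_comp.
  - by rewrite hout => [|j jn]; [apply/gout/xout|apply/xout/ltnW].
  rewrite ltnS leq_eqVlt => /predU1P[{j}->|jn].
    have hid x : boxb (a n) (b n) x -> h x = x.
      move=> xn; apply: hout => j jn; apply/negP => xj.
      apply: (disj j n x) => //; first exact: ltn_trans jn ltn.
        by apply/eqP; rewrite ltn_eqF.
      by split; apply/boxP.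
    split=> [x xn|k x0 kx0 xn0]; first by rewrite hid // gin.
    have [q qk qx] := gcell k x0 kx0 xn0; exists q => // x /qx[xn gx].
    by rewrite hid.
  have [hj hcell] := hin j jn.
  have gid x : boxb (a j) (b j) x -> g (h x) = h x.
    move=> xj; apply: gout; apply/negP => xn.
    apply: (disj j n (h x)) => //; first exact: ltn_trans jn ltn.
      by apply/eqP; rewrite ltn_eqF.
    by split; apply/boxP; rewrite ?hj.
  split=> [x xj|k x0 kx0 xn0]; first by rewrite gid // hj.
  have [q qk qx] := hcell k x0 kx0 xn0; exists q => // x /qx[xj gx].
  by rewrite gid.
have [h [hg hout hin]] := step _ (leqnn _).
have [h' [hg' hK hK']] := gen_inv hg.
(* The inverse of [h] is generated too, so it suffices to treat [f] precomposed with [h]. *)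
have -> : f = fun x => f (h (h' x)) by apply/funext => x; rewrite hK'.
apply: (gen_comp (f := fun x => f (h x))) => //; apply: (gen_cell_map w0 w1).
- by move=> x xc; rewrite (gen_out hg) // fout.
- move=> x y xc yc /finj hxy; apply: (can_inj hK); apply: hxy; exact: gen_cube.
move=> k; have /cov[j [hj /boxP kj]] := incell_cube w0 w1 (incell_corner w0 w1 k).
have [hbox /(_ k _ (incell_corner w0 w1 k) kj)[q qk qx]] := hin j hj.
(* [h] preserves the piece, so [f] moves [h x] by the translation vector of that same piece. *)
exists q => // x /qx[xj <-]; apply: tr => //; apply/boxP; exact: hbox.
Qed.
End Main.

Theorem theorem1p1 : forall d : nat, (1 <= d)%N ->
  (forall s, is_restricted_shuffle s -> @is_Rec d s) /\
  (forall f, @is_Rec d f -> generated (@is_restricted_shuffle d) f).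
Proof. by move=> d _; split=> [s|f]; [exact: shuffle_rec|exact: rec_gen]. Qed.
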